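(* Let $N\ge n$, let $\mathbf{F}=\{f_1,\ldots,f_N\}\subset\mathbb{C}[x_1,\ldots,x_n]$ be a polynomial system with $\deg(\mathbf{F})=m$, and let $\mathbf{p}\in\mathbb{C}^n$ be an isolated singular zero of $\mathbf{F}=\mathbf{0}$. Then there exists a square polynomial system $\mathbf{F}'=\{f'_1,\ldots,f'_n\}\subset\Delta_{\mathbf{p}}(\mathbf{F})$ such that: 1. $\mathbf{p}$ is an isolated regular zero of $\mathbf{F}'=\mathbf{0}$; 2. $\deg(\mathbf{F}')\le m$.
   Context: For a finite polynomial system $\mathbf{F}\subset\mathbb{C}[x_1,\ldots,x_n]$, $\deg(\mathbf{F})$ denotes the maximum of the (total) degrees of the polynomials in $\mathbf{F}$, and $\mathbf{J}(\mathbf{F})$ denotes its Jacobian matrix. A point $\mathbf{p}\in\mathbb{C}^n$ is an isolated zero of $\mathbf{F}=\mathbf{0}$ if there is $\varepsilon>0$ such that $\mathbf{p}$ is the only zero of $\mathbf{F}$ in $\{\mathbf{y}\in\mathbb{C}^n:\|\mathbf{y}-\mathbf{p}\|<\varepsilon\}$. It is an isolated singular zero if moreover $\mathrm{rank}(\mathbf{J}(\mathbf{F})(\mathbf{p}))<n$; otherwise it is an isolated regular (simple) zero. For a polynomial system $\mathbf{F}$ and a point $\mathbf{p}$ with $\mathbf{F}(\mathbf{p})=\mathbf{0}$, $\Delta_{\mathbf{p}}(\mathbf{F})\subset\mathbb{C}[x_1,\ldots,x_n]$ denotes the smallest set of polynomials satisfying: (1) $\mathbf{F}\subset\Delta_{\mathbf{p}}(\mathbf{F})$;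 (2) if $h\in\Delta_{\mathbf{p}}(\mathbf{F})$ and $a\in\mathbb{C}\setminus\{0\}$, then $a h\in\Delta_{\mathbf{p}}(\mathbf{F})$; (3) if $h_1,h_2\in\Delta_{\mathbf{p}}(\mathbf{F})$ and $h_1(\mathbf{p})+h_2(\mathbf{p})=0$, then $h_1+h_2\in\Delta_{\mathbf{p}}(\mathbf{F})$; (4) if $h\in\Delta_{\mathbf{p}}(\mathbf{F})$, $i\in\{1,\ldots,n\}$ and $\frac{\partial h}{\partial x_i}(\mathbf{p})=0$, then $\frac{\partial h}{\partial x_i}\in\Delta_{\mathbf{p}}(\mathbf{F})$. *)

(* Defs.v *)
(* The field of complex numbers is [R[i]], for an arbitrary [R : realType]. *)
From mathcomp Require Import all_boot all_order all_algebra.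
From mathcomp Require Import reals.
From mathcomp Require Import complex mpoly.

Set Implicit Arguments.
Unset Strict Implicit.
Unset Printing Implicit Defensive.

Import Order.TTheory GRing.Theory Num.Theory.

Local Open Scope ring_scope.

Section Systems.
Context {R : realType} {n : nat}.
Local Notation C := R[i].

Implicit Types (p : 'rV[C]_n) (h : {mpoly C[n]}).

Definition mpeval h p : C := h.@[p ord0].

(* Euclidean norm of C^n, with values in R. *)
Definition cvnorm p : R := Num.sqrt (\sum_(i < n) Normc.normc (p ord0 i) ^+ 2).

(* [msize] is 1 + the total degree, and [msize 0 = 0]; the zero polynomial
   thus counts as having degree 0. *)
Definition sysdeg N (F : N.-tuple {mpoly C[n]}) : nat :=
  \max_(f <- F) (msize f).-1.

Definition jacobian N (F : N.-tuple {mpoly C[n]}) :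
    'M[{mpoly C[n]}]_(N, n) :=
  \matrix_(i, j) (tnth F i)^`M(j).

Definition jacobian_at N (F : N.-tuple {mpoly C[n]}) p : 'M[C]_(N, n) :=
  map_mx (fun h => mpeval h p) (jacobian F).

Definition is_zero N (F : N.-tuple {mpoly C[n]}) p : Prop :=
  forall f, f \in F -> mpeval f p = 0.

Definition isolated_zero N (F : N.-tuple {mpoly C[n]}) p : Prop :=
  is_zero F p /\
  exists2 eps : R, 0 < eps &
    forall y, cvnorm (y - p) < eps -> is_zero F y -> y = p.

Definition isolated_singular_zero N (F : N.-tuple {mpoly C[n]}) p : Prop :=
  isolated_zero F p /\ (\rank (jacobian_at F p) < n)%N.

Definition isolated_regular_zero N (F : N.-tuple {mpoly C[n]}) p : Prop :=
  isolated_zero F p /\ ~~ (\rank (jacobian_at F p) < n)%N.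

Inductive Delta N (F : N.-tuple {mpoly C[n]}) p : {mpoly C[n]} -> Prop :=
| Delta_sys f of f \in F : Delta F p f
| Delta_scale (a : C) h of a != 0 & Delta F p h : Delta F p (a *: h)
| Delta_add h1 h2 of Delta F p h1 & Delta F p h2
    & mpeval h1 p + mpeval h2 p = 0 : Delta F p (h1 + h2)
| Delta_deriv h (i : 'I_n) of Delta F p h & mpeval h^`M(i) p = 0 :
    Delta F p h^`M(i).

End Systems.

(* Main.v *)
(* [Delta F p] is a linear space of polynomials vanishing at [p], of degree at
   most [deg F].  If the gradients at [p] of its elements span [C^n], any [n]
   elements with independent gradients answer the question.  Otherwise let
   [H_1, ..., H_k], [k < n], be elements whose gradients form a basis of the
   span, and let [u] be a polynomial vector field with [u(p) <> 0] that kills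
   every [H_i].  Every [h] in [Delta F p] is a linear combination of the [H_i]
   plus an [h0] with zero gradient at [p], and the partial derivatives of [h0]
   are again in [Delta F p]; so the derivation along [u] maps [Delta F p] into
   the ideal it generates, which has finitely many generators.  The integral
   curve of [u] through [p] therefore stays in the zero set of [F], and [p] is
   not isolated.  Instead of integrating [u], we follow Euler polygons up to a
   fixed small time: the residues of the generators tend to [0] with the step,
   and a cluster point of the end points is a zero different from [p]. *)
Require Import Defs.
From mathcomp Require Import all_boot all_order all_algebra.
From mathcomp Require Import boolp classical_sets reals.
From mathcomp Require Import complex mpoly.
From mathcomp Require Import ring lra.

Set Implicit Arguments.
Unset Strict Implicit.
Unset Printing Implicit Defensive.

Import Order.TTheory GRing.Theory Num.Theory Normc.

Local Open Scope ring_scope.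

(** * Cluster points of bounded real sequences *)

Definition frequently (P : nat -> Prop) : Prop :=
  forall k0, exists2 k, (k0 <= k)%N & P k.

(* A decreasing family [S] (as [eta] shrinks to [0]) of infinite sets of
   indices stands for a subsequence here: refining it coordinate by coordinate
   avoids extracting subsequences. *)
Lemma real_cluster_point (R : realType) (S : R -> nat -> Prop) (x : nat -> R)
    (M : R) :
  (forall a b k, a <= b -> S a k -> S b k) ->
  (forall eta, 0 < eta -> frequently (S eta)) ->
  (forall k, `|x k| <= M) ->
  exists c, forall eta, 0 < eta ->
    frequently (fun k => S eta k /\ `|x k - c| <= eta).
Proof.
move=> Smono Sfreq xM.
(* [sup T] is the limit superior of [x] along the indices selected by [S]. *)
pose T := [set t | forall eta, 0 < eta ->
  frequently (fun k => S eta k /\ t <= x k)]%classic.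
have T0 : (T !=set0)%classic.
  exists (- M) => eta eta0 k0; have [k kk0 Sk] := Sfreq _ eta0 k0.
  by exists k => //; split=> //; have := xM k; rewrite ler_norml => /andP[].
have TM : ubound T M.
  move=> t Tt; have [k _ [_ tk]] := Tt 1 ltr01 0%N.
  by apply: le_trans tk _; have := xM k; rewrite ler_norml => /andP[].
exists (sup T) => eta eta0 k0.
have [t Tt tc] := sup_adherent eta0 (conj T0 (ex_intro _ M TM)).
(* Failure of [T] just above its supremum gives a scale [e1] and a rank [k1] beyond which [x] stays
   below [sup T + eta] on [S e1]; the smaller of [eta] and [e1] serves for both sides. *)
have /existsNP[e1 /not_implyP[e10 /existsNP[k1 nk1]]] : ~ T (sup T + eta).
  move=> Tc; suff: sup T + eta <= sup T by lra.
  by apply: ub_le_sup => //; exists M.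
have e20 : 0 < Num.min eta e1 by rewrite lt_min eta0.
have [k kk [Sk tk]] := Tt _ e20 (maxn k0 k1).
move: kk; rewrite geq_max => /andP[kk0 kk1]; exists k => //.
split; first by apply: Smono Sk; rewrite ge_min lexx.
have : ~ (sup T + eta <= x k).
  move=> h; apply: nk1; exists k => //; split=> //.
  by apply: Smono Sk; rewrite ge_min lexx orbT.
by move/negP; rewrite -ltNge ler_norml => ?; apply/andP; split; lra.
Qed.

(** Induction on the number [j] of coordinates already under control: the indices at which the first
    [j] coordinates are close to their limits form the family [S] from which the next limit is
    drawn. *)
Lemma family_cluster_point (R : realType) (m : nat) (x : 'I_m -> nat -> R)
    (M : R) :
  (forall i k, `|x i k| <= M) ->
  exists c : 'I_m -> R, forall eta, 0 < eta ->
    frequently (fun k => forall i, `|x i k - c i| <= eta).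
Proof.
move=> xM.
suff cluster j : (j <= m)%N -> exists c : 'I_m -> R, forall eta, 0 < eta ->
    frequently (fun k => forall i : 'I_m, (i < j)%N -> `|x i k - c i| <= eta).
  have [c hc] := cluster m (leqnn m).
  exists c => eta eta0 k0; have [k kk0 h] := hc eta eta0 k0.
  by exists k => // i; apply: h.
elim: j => [_|j IH jm]; first by exists (fun=> 0) => eta _ k0; exists k0.
have [c hc] := IH (ltnW jm); pose j' := Ordinal jm.
pose S eta k := forall i : 'I_m, (i < j)%N -> `|x i k - c i| <= eta.
have Smono a b k : a <= b -> S a k -> S b k.
  by move=> ab Sa i ij; apply: le_trans ab; apply: Sa.
have [d hd] := real_cluster_point Smono hc (xM j').
exists (fun i => if i == j' then d else c i) => eta eta0 k0.
have [k kk0 [Sk dk]] := hd eta eta0 k0; exists k => // i.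
rewrite ltnS leq_eqVlt; have [-> // | ij] := eqVneq i j'.
by case/orP=> [/eqP e|]; [case/eqP: ij; apply: val_inj | apply: Sk].
Qed.

(** * The complex modulus, and cluster points in [C^n] *)

Section ComplexModulus.
Variable R : realType.
Local Notation C := R[i].
Implicit Types z : C.

Lemma normc_ge0 z : 0 <= normc z.
Proof. by case: z => a b; rewrite sqrtr_ge0. Qed.

Lemma normcB z w : normc (z - w) = normc (w - z).
Proof. by rewrite -(normcN (w - z)) opprB. Qed.

Lemma normc_real (r : R) : normc (r%:C)%C = `|r|.
Proof. by rewrite /= expr0n addr0 sqrtr_sqr. Qed.

Lemma normc_sum (I : Type) (s : seq I) (P : pred I) (f : I -> C) :
  normc (\sum_(i <- s | P i) f i) <= \sum_(i <- s | P i) normc (f i).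
Proof.
elim/big_rec2: _ => [|i y z _ h]; first by rewrite (normc0 R).
by apply: le_trans (le_normcD _ _) _; rewrite lerD2l.
Qed.

Lemma normc_Re z : `|complex.Re z| <= normc z.
Proof.
case: z => a b /=; rewrite -sqrtr_sqr ler_wsqrtr //.
by rewrite lerDl sqr_ge0.
Qed.

Lemma normc_Im z : `|complex.Im z| <= normc z.
Proof.
case: z => a b /=; rewrite -sqrtr_sqr ler_wsqrtr //.
by rewrite lerDr sqr_ge0.
Qed.

Lemma normc_le_ReIm z : normc z <= `|complex.Re z| + `|complex.Im z|.
Proof.
case: z => a b /=.
rewrite -(ger0_norm (addr_ge0 (normr_ge0 a) (normr_ge0 b))) -sqrtr_sqr.
rewrite ler_wsqrtr // sqrrD !real_normK ?num_real //.
by rewrite -addrA lerD2l lerDr mulrn_wge0 // mulr_ge0.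
Qed.

Lemma complex_cluster_point (n : nat) (p : 'I_n -> C) (y : nat -> 'I_n -> C)
    (M : R) :
  (forall k i, normc (y k i - p i) <= M) ->
  exists z : 'I_n -> C, forall eta, 0 < eta ->
    frequently (fun k => forall i, normc (y k i - z i) <= eta).
Proof.
move=> yM.
(* Real and imaginary parts form [n + n] bounded real sequences; each is approximated within
   [eta / 2], since the modulus is at most the sum of the two parts. *)
pose x (i : 'I_(n + n)) k := match split i with
  | inl j => complex.Re (y k j - p j) | inr j => complex.Im (y k j - p j) end.
have xM i k : `|x i k| <= M.
  by rewrite /x; case: split => j; apply: le_trans (yM k j);
    rewrite ?normc_Re ?normc_Im.
have [c hc] := family_cluster_point xM.
exists (fun j => p j + (c (lshift n j) +i* c (rshift n j))%C) => eta eta0 k0.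
have [k kk0 h] := hc (eta / 2) (divr_gt0 eta0 (ltr0Sn _ _)) k0.
exists k => // j; apply: le_trans (normc_le_ReIm _) _.
have := h (lshift n j); have := h (rshift n j).
rewrite /x (unsplitK (inl j)) (unsplitK (inr j)) opprD addrA.
by case: (y k j - p j) => a b /=; lra.
Qed.

End ComplexModulus.

(** * First-order Taylor estimates for polynomials on a box *)

Lemma three_bounds (R : realFieldType) (P s a b c x : R) :
  a <= P * s -> b <= P * s -> c <= P * s -> x <= a + b + c ->
  x <= 3 * P * s.
Proof. by move=> ? ? ?; lra. Qed.

Section TaylorBounds.
Variables (R : realType) (n : nat).
Local Notation C := R[i].
Implicit Types (h g : {mpoly C[n]}) (p y z v : 'I_n -> C) (r M : R).

Definition differential h y v : C := \sum_i (h^`M(i)).@[y] * v i.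

Lemma differentialD h g y v :
  differential (h + g) y v = differential h y v + differential g y v.
Proof.
rewrite -big_split; apply: eq_bigr => i _ /=.
by rewrite mderivD mevalD mulrDl.
Qed.

Lemma differentialM h g y v : differential (h * g) y v =
  h.@[y] * differential g y v + g.@[y] * differential h y v.
Proof.
rewrite !mulr_sumr -big_split; apply: eq_bigr => i _ /=.
by rewrite mderivM mevalD 2!mevalM mulrDl addrC -2!mulrA mulrCA.
Qed.

Lemma differentialC c y v : differential c%:MP y v = 0.
Proof. by apply: big1 => i _; rewrite mderivC meval0 mul0r. Qed.

Lemma differentialX i y v : differential 'X_i y v = v i.
Proof.
rewrite /differential (bigD1 i) //= big1 => [|j ji].
  by rewrite mderivX mnm1E eqxx scale1r -{1}[U_(i)%MM]add0m addmK mpolyX0 meval1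
       mul1r addr0.
by rewrite mderivX mnm1E eq_sym (negPf ji) scale0r meval0 mul0r.
Qed.

Definition in_box p r y := forall i, normc (y i - p i) <= r.

(** Value, increment and quadratic remainder share one constant because the remainder of a product
    involves all three for its factors. Here [r] is any bound on the coordinates of [z - y], not the
    exact distance. *)
Definition taylor_bound p M h := forall y z r,
  0 <= r -> in_box p 1 y -> in_box p 1 z -> in_box y r z ->
  [/\ normc h.@[y] <= M, normc (h.@[z] - h.@[y]) <= M * r
    & normc (h.@[z] - h.@[y] - differential h y (fun i => z i - y i))
      <= M * r ^+ 2].

Lemma taylor_boundW p M M' h :
  M <= M' -> taylor_bound p M h -> taylor_bound p M' h.
Proof.
move=> MM hM y z r r0 yp zp zy; have [h1 h2 h3] := hM y z r r0 yp zp zy.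
split; first exact: le_trans MM.
  by apply: le_trans h2 _; rewrite ler_wpM2r.
by apply: le_trans h3 _; rewrite ler_wpM2r ?sqr_ge0.
Qed.

Lemma taylor_boundC p c : taylor_bound p (normc c) c%:MP.
Proof.
move=> y z r r0 yp zp zy; rewrite differentialC !mevalC subrr subr0.
by split; rewrite // ?(normc0 R) mulr_ge0 ?normc_ge0 ?sqr_ge0.
Qed.

Lemma taylor_boundX p i : taylor_bound p (1 + normc (p i)) 'X_i.
Proof.
move=> y z r r0 yp zp zy; rewrite differentialX !mevalXU subrr.
have p0 := normc_ge0 (p i); split.
- rewrite -[y i](subrK (p i)); apply: le_trans (le_normcD _ _) _.
  by rewrite lerD2r yp.
- by apply: le_trans (zy i) _; rewrite -[leLHS]mul1r ler_wpM2r // lerDl.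
- by rewrite (normc0 R) mulr_ge0 ?sqr_ge0 ?addr_ge0.
Qed.

Lemma taylor_boundD p M1 M2 h g : taylor_bound p M1 h -> taylor_bound p M2 g ->
  taylor_bound p (M1 + M2) (h + g).
Proof.
move=> hM gM y z r r0 yp zp zy.
have [h1 h2 h3] := hM y z r r0 yp zp zy.
have [g1 g2 g3] := gM y z r r0 yp zp zy.
rewrite differentialD !mevalD; split.
- by apply: le_trans (le_normcD _ _) _; apply: lerD.
- by rewrite opprD addrACA mulrDl; apply: le_trans (le_normcD _ _) _; exact: lerD.
have -> (a b c d e f : C) : a + b - (c + d) - (e + f) = (a - c - e) + (b - d - f).
  by ring.
rewrite mulrDl.
by apply: le_trans (le_normcD _ _) _; apply: lerD.
Qed.

Lemma taylor_boundM p M1 M2 h g : taylor_bound p M1 h -> taylor_bound p M2 g ->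
  taylor_bound p (3 * (M1 * M2)) (h * g).
Proof.
move=> hM gM y z r r0 yp zp zy.
have [h1 h2 h3] := hM y z r r0 yp zp zy.
have [g1 g2 g3] := gM y z r r0 yp zp zy.
(* The bound on the value at [z] comes from the degenerate pair [(z, z)] with radius [0]. *)
have z0 : in_box z 0 z by move=> i; rewrite subrr (normc0 R).
have [h1' _ _] := hM z z 0 (lexx 0) zp zp z0.
rewrite differentialM !mevalM.
have prodM (a b : C) A B : normc a <= A -> normc b <= B -> normc (a * b) <= A * B.
  by move=> aA bB; rewrite normcM ler_pM ?normc_ge0.
have M12 : 0 <= M1 * M2 by apply: le_trans (normc_ge0 _) (prodM _ _ _ _ h1 g1).
set hy := h.@[y] in h1 h2 h3 *; set hz := h.@[z] in h1' h2 h3 *.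
set gy := g.@[y] in g1 g2 g3 *; set gz := g.@[z] in g2 g3 *.
split.
- by apply: le_trans (prodM _ _ _ _ h1 g1) _; rewrite ler_peMl ?ler1n.
- have -> : hz * gz - hy * gy = hz * (gz - gy) + (hz - hy) * gy.
    by rewrite mulrBr mulrBl addrA subrK.
  have a1 := prodM _ _ _ _ h1' g2; have a2 := prodM _ _ _ _ h2 g1.
  rewrite mulrA in a1; rewrite mulrAC in a2.
  by apply: three_bounds (mulr_ge0 M12 r0) a1 a2 _;
    rewrite add0r le_normcD.
set dh := differential h _ _ in h3 *; set dg := differential g _ _ in g3 *.
(* The remainder of a product is the product of the increments plus each factor times the remainder
   of the other: three terms of order [r ^+ 2], whence the factor [3]. *)
have -> : hz * gz - hy * gy - (hy * dg + gy * dh) =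
    (hz - hy) * (gz - gy) + (hy * (gz - gy - dg) + gy * (hz - hy - dh)).
  by move: (hz) (gz) (hy) (gy) (dh) (dg) => a b c d e f; ring.
have a1 := prodM _ _ _ _ h2 g2; have a2 := prodM _ _ _ _ h1 g3.
have a3 := prodM _ _ _ _ g1 h3.
rewrite mulrACA -expr2 in a1; rewrite mulrA in a2; rewrite mulrCA mulrA in a3.
apply: three_bounds a1 a2 a3 _.
by apply: le_trans (le_normcD _ _) _; rewrite -[leRHS]addrA lerD2l le_normcD.
Qed.

Lemma taylor_bound_exists p h : exists M, taylor_bound p M h.
Proof.
elim/mpolyind: h => [|c m h _ _ [M hM]].
  by exists (normc (0 : C)); rewrite -mpolyC0; apply: taylor_boundC.
suff [M' hM'] : exists M', taylor_bound p M' 'X_[m].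
  exists (3 * (normc c * M') + M); rewrite -mul_mpolyC.
  by apply: taylor_boundD => //; apply: taylor_boundM => //; apply: taylor_boundC.
rewrite mpolyXE_id; elim/big_rec: _ => [|i h' _ [M' hM']].
  by exists (normc (1 : C)); rewrite -mpolyC1; apply: taylor_boundC.
elim: (m i) => [|k [M'' IH]]; first by exists M'; rewrite expr0 mul1r.
exists (3 * ((1 + normc (p i)) * M'')); rewrite exprS -mulrA.
by apply: taylor_boundM => //; apply: taylor_boundX.
Qed.

Lemma taylor_bound_family p (I : finType) (h : I -> {mpoly C[n]}) :
  exists M, forall i, taylor_bound p M (h i).
Proof.
have [M hM] := choice (fun i => taylor_bound_exists p (h i)).
exists (\sum_i `|M i|) => i; apply: taylor_boundW (hM i).
rewrite (bigD1 i) //=; apply: le_trans (ler_norm _) _.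
by rewrite lerDl sumr_ge0.
Qed.

End TaylorBounds.

(** * Euler polygons and the growth of the residues along them *)

Lemma euler_error_step (R : realFieldType) (d M k delta E E' : R) :
  0 <= d -> 0 <= M -> 0 <= k -> 0 <= delta -> 2 * (d * M) * (k * delta) <= 1 ->
  E <= 2 * (d * M ^+ 3) * k * delta ^+ 2 ->
  E' <= E + d * (delta * (M * E) + M * (delta * M) ^+ 2) ->
  E' <= 2 * (d * M ^+ 3) * (k + 1) * delta ^+ 2.
Proof.
move=> d0 M0 k0 t0 small hE hE'; apply: le_trans hE' _.
(* A discrete Gronwall estimate without exponentials: as the elapsed time [k * delta] is small,
   amplifying the old error costs at most [B * delta ^+ 2], as much as the new Taylor remainder.
   Each step thus adds at most twice that. *)
set B := d * M ^+ 3 in hE *.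
have B0 : 0 <= B * delta ^+ 2 by rewrite /B !(mulr_ge0, exprn_ge0, sqr_ge0).
have dMt : 0 <= d * M * delta by rewrite !mulr_ge0.
have h1 := ler_wpM2l dMt hE; have h2 := ler_wpM2r B0 small.
have -> : E + d * (delta * (M * E) + M * (delta * M) ^+ 2) =
  E + d * M * delta * E + B * delta ^+ 2 by rewrite /B; ring.
have e1 : d * M * delta * (2 * B * k * delta ^+ 2) =
  2 * (d * M) * (k * delta) * (B * delta ^+ 2) by ring.
have e2 : 2 * B * (k + 1) * delta ^+ 2 =
  2 * B * k * delta ^+ 2 + 2 * (B * delta ^+ 2) by ring.
rewrite e1 in h1; rewrite e2.
by clear -hE h1 h2; lra.
Qed.

Section EulerPolygon.
Variables (R : realType) (n d : nat).
Local Notation C := R[i].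
Variables (p : 'I_n -> C) (u : 'I_n -> {mpoly C[n]}).
Variables (b : 'I_d -> {mpoly C[n]}) (a : 'I_d -> 'I_d -> {mpoly C[n]}).
Hypothesis bp0 : forall i, (b i).@[p] = 0.
Hypothesis u_derives_b :
  forall i, \sum_l (b i)^`M(l) * u l = \sum_j a i j * b j.

Definition euler_step (delta : R) (y : 'I_n -> C) : 'I_n -> C :=
  fun i => y i + (delta%:C)%C * (u i).@[y].

Variable M : R.
Hypothesis M_ge0 : 0 <= M.
Hypothesis uM : forall i, taylor_bound p M (u i).
Hypothesis bM : forall i, taylor_bound p M (b i).
Hypothesis aM : forall i j, taylor_bound p M (a i j).

Lemma in_box0 r y : 0 <= r -> @in_box R n y r y.
Proof. by move=> r0 i; rewrite subrr (normc0 R). Qed.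

Lemma taylor_bound_le (h : {mpoly C[n]}) (y : 'I_n -> C) :
  taylor_bound p M h -> in_box p 1 y -> normc h.@[y] <= M.
Proof.
by move=> hM yp; case: (hM y y 0 (lexx 0) yp yp (in_box0 _ (lexx 0))).
Qed.

Definition total_residue (y : 'I_n -> C) : R := \sum_j normc (b j).@[y].

(** The first-order change of [b j] is [delta] times its derivative along [u], which is a
    combination of the [b]'s and so is controlled by the residue itself; only the Taylor remainder
    is new, quadratic in the step length [delta * M]. *)
Lemma total_residue_step delta y : 0 <= delta ->
  in_box p 1 y -> in_box p 1 (euler_step delta y) ->
  total_residue (euler_step delta y) <= total_residue y +
    d%:R * (delta * (M * total_residue y) + M * (delta * M) ^+ 2).
Proof.
move=> delta0 yp y'p; set E := total_residue y.
have step : in_box y (delta * M) (euler_step delta y).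
  move=> i; rewrite /euler_step addrC addKr normcM normc_real ger0_norm //.
  by rewrite ler_wpM2l // taylor_bound_le.
suff bound j : normc (b j).@[euler_step delta y] <= normc (b j).@[y] +
    (delta * (M * E) + M * (delta * M) ^+ 2).
  apply: le_trans (ler_sum _ (fun j _ => bound j)) _.
  by rewrite big_split /= sumr_const card_ord mulr_natl.
have [_ _ rem] := bM j (mulr_ge0 delta0 M_ge0) yp y'p step.
have De : differential (b j) y (fun i => euler_step delta y i - y i) =
    (delta%:C)%C * \sum_j' (a j j').@[y] * (b j').@[y].
  have := congr1 (fun h => h.@[y]) (u_derives_b j).
  rewrite !raddf_sum /= => e.
  under [in RHS]eq_bigr => j' _ do rewrite -mevalM.
  rewrite -e mulr_sumr; apply: eq_bigr => i _.
  by rewrite /euler_step addrC addKr mevalM mulrCA.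
have Dle : normc (differential (b j) y (fun i => euler_step delta y i - y i))
    <= delta * (M * E).
  rewrite De normcM normc_real ger0_norm // ler_wpM2l //.
  apply: le_trans (normc_sum _ _ _) _; rewrite mulr_sumr; apply: ler_sum => j' _.
  by rewrite normcM ler_wpM2r ?normc_ge0 // taylor_bound_le.
set D := differential _ _ _ in rem Dle.
have -> : (b j).@[euler_step delta y] = (b j).@[y] +
    (D + ((b j).@[euler_step delta y] - (b j).@[y] - D)).
  by rewrite (addrC D) subrK addrC subrK.
apply: le_trans (le_normcD _ _) _; rewrite lerD2l.
by apply: le_trans (le_normcD _ _) _; apply: lerD.
Qed.

(** Three invariants of the polygon: it moves at speed at most [M], hence stays where the Taylor
    bounds apply; it stays close to the line through [p] with direction [u(p)]; its residue is of
    order [k * delta ^+ 2], which at time [s] tends to [0] with the step. *)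
Lemma euler_polygon s K (delta := s / K.+1%:R) k :
  0 <= s -> s * M <= 1 -> 2 * (d%:R * M) * s <= 1 -> (k <= K.+1)%N ->
  let y := iter k (euler_step delta) p in
  [/\ in_box p (k%:R * delta * M) y,
      forall i, normc (y i - p i - ((k%:R * delta)%:C)%C * (u i).@[p]) <=
        k%:R * delta * (M * (s * M))
    & total_residue y <= 2 * (d%:R * M ^+ 3) * k%:R * delta ^+ 2].
Proof.
move=> s0 sM sd.
have delta0 : 0 <= delta by rewrite divr_ge0.
have le_s j : (j <= K.+1)%N -> j%:R * delta <= s.
  move=> jK; rewrite -[leRHS](divfK (_ : K.+1%:R != 0)) ?pnatr_eq0 // mulrC.
  by rewrite -/delta ler_wpM2l // ler_nat.
have p_box y j : (j <= K.+1)%N -> in_box p (j%:R * delta * M) y -> in_box p 1 y.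
  move=> jK yp i; apply: le_trans (yp i) _; apply: le_trans sM.
  by rewrite ler_wpM2r // le_s.
elim: k => [_ /=|k IH kK].
  split=> [|i|].
  - by apply: in_box0; rewrite !mul0r.
  - by rewrite !mul0r subrr subr0 (normc0 R).
  - by rewrite mulr0 mul0r /total_residue big1 // => j _; rewrite bp0 (normc0 R).
have {IH} := IH (ltnW kK); rewrite iterS; set y := iter k _ p => -[y1 y2 y3] y'.
have yp := p_box _ _ (ltnW kK) y1.
have y'1 : in_box p (k.+1%:R * delta * M) y'.
  move=> i; rewrite /y' /euler_step addrAC -natr1 2!mulrDl mul1r.
  apply: le_trans (le_normcD _ _) _; apply: lerD => //.
  by rewrite normcM normc_real ger0_norm // ler_wpM2l // taylor_bound_le.
have y'p := p_box _ _ kK y'1.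
split=> // [i|].
  have -> : y' i - p i - ((k.+1%:R * delta)%:C)%C * (u i).@[p] =
      (y i - p i - ((k%:R * delta)%:C)%C * (u i).@[p]) +
      (delta%:C)%C * ((u i).@[y] - (u i).@[p]).
    rewrite /y' /euler_step -natr1 mulrDl mul1r rmorphD /=.
    move: (y i) (p i) (u i).@[p] (u i).@[y] (delta%:C)%C ((k%:R * delta)%:C)%C.
    by move=> c1 c2 c3 c4 c5 c6; ring.
  rewrite -natr1 2!mulrDl mul1r.
  apply: le_trans (le_normcD _ _) _; apply: lerD => //.
  rewrite normcM normc_real ger0_norm // ler_wpM2l //.
  have ys : in_box p (s * M) y.
    by move=> j; apply: le_trans (y1 j) _; rewrite ler_wpM2r // le_s // ltnW.
  by case: (uM i (mulr_ge0 s0 M_ge0) (in_box0 p ler01) yp ys).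
rewrite -[k.+1%:R]natr1.
apply: (@euler_error_step _ _ _ _ _ (total_residue y)) => //.
  apply: le_trans sd; rewrite ler_wpM2l ?mulr_ge0 // le_s // ltnW //.
exact: total_residue_step.
Qed.

End EulerPolygon.

(** * A second common zero as a limit of Euler end points *)

Lemma exists_small_scale (R : realFieldType) (c : seq R) :
  exists2 s, 0 < s & forall x, x \in c -> s * x <= 1.
Proof.
elim: c => [|x c [s s0 hs]]; first by exists 1.
exists (Num.min s (1 + `|x|)^-1) => [|y].
  by rewrite lt_min s0 invr_gt0 ltr_pwDl.
have x1 : 0 < 1 + `|x| by rewrite ltr_pwDl.
set t := Num.min _ _; have t0 : 0 <= t by rewrite le_min ltW // invr_ge0 ltW.
have [ts tx] : t <= s /\ t <= (1 + `|x|)^-1 by rewrite !ge_min !lexx orbT.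
rewrite inE => /predU1P[->|/hs sy].
  apply: (@le_trans _ _ (t * (1 + `|x|))).
    by rewrite ler_wpM2l // (le_trans (ler_norm x)) // lerDr.
  by rewrite -[leRHS](mulVf (lt0r_neq0 x1)) ler_wpM2r // ltW.
have [y0|/ltW y0] := lerP 0 y; first by apply: le_trans sy; rewrite ler_wpM2r.
by apply: le_trans (mulr_ge0_le0 t0 y0) _.
Qed.

Lemma natr_inv_eventually_small (R : realType) (c e : R) : 0 < e ->
  exists k0, forall k, (k0 <= k)%N -> c / k.+1%:R <= e.
Proof.
move=> e0; exists (Num.bound (`|c| / e)) => k kk0.
rewrite ler_pdivrMr ?ltr0Sn //; apply: le_trans (ler_norm c) _.
have /ltW := archi_boundP (divr_ge0 (normr_ge0 c) (ltW e0)).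
rewrite ler_pdivrMr // mulrC => /le_trans; apply.
by rewrite ler_wpM2l ?ltW // ltr_nat ltnS.
Qed.

Lemma tangent_field_zero (R : realType) (n d : nat) (p : 'I_n -> R[i])
    (u : 'I_n -> {mpoly R[i][n]}) (b : 'I_d -> {mpoly R[i][n]})
    (a : 'I_d -> 'I_d -> {mpoly R[i][n]}) (l : 'I_n) (rho : R) :
  (forall i, (b i).@[p] = 0) ->
  (forall i, \sum_l (b i)^`M(l) * u l = \sum_j a i j * b j) ->
  (u l).@[p] != 0 -> 0 < rho ->
  exists z : 'I_n -> R[i],
    [/\ z l != p l, in_box p rho z & forall i, (b i).@[z] = 0].
Proof.
move=> bp0 uab ul rho0.
have [Mu hMu] := taylor_bound_family p u.
have [Mb hMb] := taylor_bound_family p b.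
have [Ma hMa] := taylor_bound_family p (fun ij : 'I_d * 'I_d => a ij.1 ij.2).
pose M := `|Mu| + `|Mb| + `|Ma|.
have M0 : 0 <= M by rewrite !addr_ge0.
have uM i : taylor_bound p M (u i).
  by apply: taylor_boundW (hMu i);
    rewrite /M (le_trans (ler_norm _)) // -addrA lerDl addr_ge0.
have bM i : taylor_bound p M (b i).
  by apply: taylor_boundW (hMb i);
    rewrite /M (le_trans (ler_norm _)) // addrAC lerDr addr_ge0.
have aM i j : taylor_bound p M (a i j).
  by apply: taylor_boundW (hMa (i, j));
    rewrite /M (le_trans (ler_norm _)) // lerDr addr_ge0.
have c0 : 0 < normc (u l).@[p].
  rewrite lt_neqAle normc_ge0 andbT eq_sym; apply: contra ul => /eqP e.
  by rewrite (eq0_normc e).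
set c := normc _ in c0.
(* The four constants ensure in turn that the polygons stay in the unit box, that the residue
   estimate applies, that the end points stay within [rho] of [p], and that the drift off the
   tangent line is at most half the displacement [s * c]. *)
have [s s0 hs] :=
  exists_small_scale [:: M; 2 * (d%:R * M); M / rho; 2 * M ^+ 2 / c].
have sM : s * M <= 1 by apply: hs; rewrite !inE eqxx.
have sd : 2 * (d%:R * M) * s <= 1
  by rewrite mulrC; apply: hs; rewrite !inE eqxx !orbT.
have srho : s * M <= rho.
  by rewrite -[leRHS]mul1r -ler_pdivrMr // -mulrA; apply: hs;
     rewrite !inE eqxx !orbT.
have sc : M * (s * M) <= c / 2.
  rewrite ler_pdivlMr // -[leRHS]mul1r -ler_pdivrMr //.
  have -> : M * (s * M) * 2 / c = s * (2 * M ^+ 2 / c).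
    by move: (c^-1) => c'; clear; ring.
  by apply: hs; rewrite !inE eqxx !orbT.
pose y K := iter K.+1 (euler_step u (s / K.+1%:R)) p.
have sK K : K.+1%:R * (s / K.+1%:R) = s by rewrite mulrC divfK ?pnatr_eq0.
have yP K : [/\ in_box p (s * M) (y K),
    forall i, normc (y K i - p i - (s%:C)%C * (u i).@[p]) <= s * (M * (s * M))
  & total_residue b (y K) <= 2 * (d%:R * M ^+ 3) * s ^+ 2 / K.+1%:R].
  have := euler_polygon bp0 uab M0 uM bM aM (ltW s0) sM sd (leqnn K.+1).
  rewrite -/(y K) sK => -[h1 h2 h3]; split=> //; apply: le_trans h3 _.
  by rewrite -[leLHS]mulrA [X in _ * (_ * X) <= _]expr2 (mulrA K.+1%:R) sK !mulrA.
have [z zP] := complex_cluster_point (fun K => let: And3 h _ _ := yP K in h).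
have zbox : in_box p (s * M) z.
  move=> i; apply/ler_addgt0Pr => eta eta0.
  have [K _ /(_ i) yz] := zP eta eta0 0%N; have [/(_ i) yp _ _] := yP K.
  have -> : z i - p i = (y K i - p i) + (z i - y K i).
    by rewrite [RHS]addrC addrA subrK.
  by apply: le_trans (le_normcD _ _) _; apply: lerD => //; rewrite normcB.
have in1 w : in_box p (s * M) w -> in_box p 1 w.
  by move=> h i; apply: le_trans (h i) sM.
exists z; split.
(* If [z l = p l], a close end point would have its tangential displacement [s * c] bounded by a
   quarter plus a half of itself. *)
- apply/eqP => zp; have e0 : 0 < s * (c / 2) / 2
    by rewrite divr_gt0 ?ltr0Sn // mulr_gt0 // divr_gt0 ?ltr0Sn.
  have [K _ /(_ l)] := zP _ e0 0%N; have [_ /(_ l) h _] := yP K.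
  rewrite zp; set v := y K l - p l in h * => v_small.
  have : normc ((s%:C)%C * (u l).@[p]) <= s * (c / 2) / 2 + s * (c / 2).
    rewrite -[X in normc X](subKr v); apply: le_trans (le_normcD _ _) _.
    apply: lerD => //; rewrite normcN; apply: le_trans h _.
    by apply: ler_wpM2l => //; apply: ltW.
  rewrite normcM normc_real gtr0_norm // -/c; have := mulr_gt0 s0 c0.
  by clear; lra.
- by move=> i; apply: le_trans (zbox i) srho.
move=> i; apply: eq0_normc; apply/eqP; rewrite eq_le normc_ge0 andbT.
apply/ler_addgt0Pr => e e0; rewrite add0r.
have [k0 hk0] := natr_inv_eventually_small
  (2 * (d%:R * M ^+ 3) * s ^+ 2) (divr_gt0 e0 (ltr0Sn _ 1)).
(* Within [e / (2 * (1 + M))] of [z], the Lipschitz bound costs at most [e / 2]; the residue at the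
   end point accounts for the other half. *)
have M1 : 0 < 2 * (1 + M) by rewrite mulr_gt0 // ltr_pwDl.
have [K kk0 yz] := zP (e / (2 * (1 + M))) (divr_gt0 e0 M1) k0.
have [yp _ res] := yP K.
have zy : in_box (y K) (e / (2 * (1 + M))) z by move=> j; rewrite normcB.
have [_ h _] := bM i _ _ _ (ltW (divr_gt0 e0 M1)) (in1 _ yp) (in1 _ zbox) zy.
rewrite -[(b i).@[z]](subrK (b i).@[y K]) [e]splitr.
apply: le_trans (le_normcD _ _) _; apply: lerD.
  apply: le_trans h _; rewrite mulrCA ler_wpM2l ?(ltW e0) // invfM mulrCA.
  by rewrite ler_piMr ?invr_ge0 // ler_pdivrMr ?mul1r ?lerDr ?ltr_pwDl.
apply: le_trans (hk0 K kk0); apply: le_trans res.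
by rewrite /total_residue (bigD1 i) //= lerDl sumr_ge0 // => j _; apply: normc_ge0.
Qed.

(** * Linear algebra of gradients and of spaces of polynomials *)

Lemma row_free_span_exists (K : fieldType) (m : nat) (P : 'rV[K]_m -> Prop) :
  exists k (B : 'M[K]_(k, m)),
    [/\ row_free B, forall i, P (row i B) & forall v, P v -> (v <= B)%MS].
Proof.
apply: contrapT => noB.
(* If no free family within [P] spanned it, each could be enlarged, up to [m + 1] independent rows
   of length [m]. *)
suff /(_ m.+1)[B [/eqP rB _]] :
    forall k, exists B : 'M[K]_(k, m), row_free B /\ forall i, P (row i B).
  by have := rank_leq_col B; rewrite rB ltnn.
elim=> [|k [B [Bfree BP]]].
  by exists 0; split=> [|[]//]; rewrite /row_free mxrank0.
have [v [Pv vB]] : exists v, P v /\ ~~ (v <= B)%MS.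
  apply: contrapT => noV; apply: noB; exists k, B; split=> // v Pv.
  by apply/negPn/negP => vB; apply: noV; exists v.
have vC : (v <= col_mx v B)%MS by rewrite -addsmxE addsmxSl.
have BC : (B <= col_mx v B)%MS by rewrite -addsmxE addsmxSr.
have rowP (i : 'I_(1 + k)) : P (row i (col_mx v B)).
  by case: (split_ordP i) => j ->; rewrite ?rowKu ?rowKd // ord1 row_id.
exists (col_mx v B : 'M_(1 + k, m)); split=> //.
rewrite /row_free eqn_leq rank_leq_row -[X in (X < _)%N](eqP Bfree).
apply: rank_ltmx; rewrite ltmxE; apply/andP; split=> //.
by apply: contra vB; apply: submx_trans.
Qed.

Section PolynomialSubspace.
Variables (K : fieldType) (n : nat) (p : 'I_n -> K).
Variable V : {mpoly K[n]} -> Prop.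
Hypothesis V_lin : forall c h g, V h -> V g -> V (c *: h + g).

Lemma subspace_sum (I : Type) (s : seq I) (c : I -> K) (f : I -> {mpoly K[n]}) g :
  (forall i, V (f i)) -> V g -> V (\sum_(i <- s) c i *: f i + g).
Proof.
move=> Vf Vg; elim: s => [|i s IH]; first by rewrite big_nil add0r.
by rewrite big_cons -addrA; apply: V_lin.
Qed.

(** Bounded size places [V] in the finite-dimensional space spanned by the monomials of degree below
    [k]; the generators come from a maximal free family of coefficient vectors. *)
Lemma bounded_subspace_generators (k : nat) :
  (forall h, V h -> (msize h <= k)%N) ->
  exists d (b : 'I_d -> {mpoly K[n]}), (forall i, V (b i)) /\
    forall h, V h -> exists c : 'I_d -> K, h = \sum_i c i *: b i.
Proof.
move=> Vk; pose N := #|{: 'X_{1..n < k}}|.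
pose phi (v : 'rV[K]_N) : {mpoly K[n]} :=
  \sum_j v ord0 j *: 'X_[bmnm (enum_val j)].
have [d [B [_ BV BE]]] := row_free_span_exists (fun v => V (phi v)).
exists d, (fun i => phi (row i B)); split=> // h Vh.
pose v : 'rV[K]_N := \row_j h@_(bmnm (enum_val j)).
have hE : h = phi v.
  rewrite [LHS](mpolywE (Vk h Vh)) (reindex (@enum_val _ {: 'X_{1..n < k}})) /=.
    by apply: eq_bigr => j _; rewrite mxE.
  exact: onW_bij (enum_val_bij _).
have /submxP[w vE] : (v <= B)%MS by apply: BE; rewrite -hE.
exists (fun i => w ord0 i); rewrite [LHS]hE vE /phi.
under eq_bigr => j _ do rewrite mxE scaler_suml.
rewrite exchange_big; apply: eq_bigr => i _ /=.
by rewrite scaler_sumr; apply: eq_bigr => j _; rewrite mxE scalerA.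
Qed.

Definition gradient_at (h : {mpoly K[n]}) : 'rV[K]_n := \row_j (h^`M(j)).@[p].

(* With [J] the Jacobian of [H], [B] its value at [p] and [B Q = 1], the
   columns of [U = det (J Q) - Q adj (J Q) J] are annihilated by [J], and
   [U] takes the value [1 - Q B != 0] at [p]. *)
Lemma polynomial_kernel_field (k : nat) (H : 'I_k -> {mpoly K[n]})
    (B : 'M[K]_(k, n)) :
  (k < n)%N -> row_free B -> (forall i, row i B = gradient_at (H i)) ->
  exists (u : 'I_n -> {mpoly K[n]}) (l : 'I_n), (u l).@[p] != 0 /\
    forall i, \sum_j (H i)^`M(j) * u j = 0.
Proof.
move=> kn /row_freeP[Q BQ] HB.
pose J : 'M[{mpoly K[n]}]_(k, n) := \matrix_(i, j) (H i)^`M(j).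
pose Qp : 'M[{mpoly K[n]}]_(n, k) := map_mx (@mpolyC n K) Q.
pose S := J *m Qp; pose U := (\det S)%:M - Qp *m \adj S *m J.
have JU : J *m U = 0.
  by rewrite mulmxBr mul_mx_scalar !mulmxA -/S mul_mx_adj mul_scalar_mx subrr.
have evJ : map_mx (meval p) J = B.
  apply/matrixP => i j; have /rowP/(_ j) := HB i.
  by rewrite !mxE => ->.
have evQ : map_mx (meval p) Qp = Q.
  by apply/matrixP => i j; rewrite !mxE mevalC.
have evS : map_mx (meval p) S = 1%:M by rewrite map_mxM evJ evQ BQ.
have evU : map_mx (meval p) U = 1%:M - Q *m B.
  rewrite map_mxB map_scalar_mx -det_map_mx evS det1 !map_mxM map_mx_adj.
  by rewrite evS evJ evQ adj1 mulmx1.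
(* Otherwise [Q *m B] would be the identity of size [n], although it factors through dimension
   [k < n]. The field is the column of [U] through a nonzero entry. *)
have [l [c ul]] : exists l c, map_mx (meval p) U l c != 0.
  apply/matrix0Pn; apply: contraTneq kn; rewrite evU => /subr0_eq e.
  by rewrite -leqNgt; apply: mulmx1_min (esym e).
exists (fun j => U j c), l; split; first by rewrite mxE in ul.
move=> i; have /matrixP/(_ i c) := JU; rewrite !mxE => e.
by rewrite -[RHS]e; apply: eq_bigr => j _; rewrite [J _ _]mxE.
Qed.

Hypothesis V_deriv : forall h i, V h -> (h^`M(i)).@[p] = 0 -> V h^`M(i).

Lemma subspace_tangent_field (k : nat) (H : 'I_k -> {mpoly K[n]})
    (B : 'M[K]_(k, n)) :
  (k < n)%N -> row_free B -> (forall i, V (H i)) ->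
  (forall i, row i B = gradient_at (H i)) ->
  (forall h, V h -> (gradient_at h <= B)%MS) ->
  exists (u : 'I_n -> {mpoly K[n]}) (l : 'I_n), (u l).@[p] != 0 /\
    forall h, V h -> exists g : 'I_n -> {mpoly K[n]}, (forall j, V (g j)) /\
      \sum_j h^`M(j) * u j = \sum_j g j * u j.
Proof.
move=> kn Bfree VH HB Bspan.
have [u [l [ul Hu]]] := polynomial_kernel_field kn Bfree HB.
exists u, l; split=> // h Vh.
have /submxP[w hw] := Bspan h Vh.
(* Subtracting the combination of the [H i] with the same gradient at [p] puts the partial
   derivatives of [h0] in [V]; as [u] kills the [H i], [h] and [h0] have the same derivative along
   [u]. *)
pose h0 := \sum_i (- w ord0 i) *: H i + h.
have Vh0 : V h0 by apply: subspace_sum.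
have h0D j : h0^`M(j) = \sum_i (- w ord0 i) *: (H i)^`M(j) + h^`M(j).
  by rewrite mderivD raddf_sum /=; congr (_ + _);
    apply: eq_bigr => i _; rewrite mderivZ.
exists (fun j => h0^`M(j)); split=> [j|].
  apply: V_deriv => //; rewrite h0D mevalD raddf_sum /=.
  have /rowP/(_ j) := hw; rewrite !mxE => ->; rewrite -big_split big1 //= => i _.
  have /rowP/(_ j) := HB i; rewrite !mxE => ->.
  by rewrite mevalZ mulNr addNr.
under [RHS]eq_bigr => j _ do rewrite h0D mulrDl mulr_suml.
rewrite big_split exchange_big /= [X in _ = X + _]big1 ?add0r // => i _.
under eq_bigr => j _ do rewrite -scalerAl.
by rewrite -scaler_sumr Hu scaler0.
Qed.

End PolynomialSubspace.

(** * Zeros of systems, and the space [Delta F p] *)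

Section Systems.
Variables (R : realType) (n : nat).
Local Notation C := R[i].

Lemma normc_le_cvnorm (v : 'rV[C]_n) i : normc (v ord0 i) <= cvnorm v.
Proof.
rewrite -[leLHS](ger0_norm (normc_ge0 _)) -sqrtr_sqr ler_wsqrtr //.
by rewrite (bigD1 i) //= lerDl sumr_ge0 // => j _; rewrite sqr_ge0.
Qed.

Lemma cvnorm_le (v : 'rV[C]_n) (r : R) :
  0 <= r -> (forall i, normc (v ord0 i) <= r) -> cvnorm v <= n%:R * r.
Proof.
move=> r0 vr; have nr0 : 0 <= n%:R * r by rewrite mulr_ge0.
rewrite -[leRHS](ger0_norm nr0) -sqrtr_sqr ler_wsqrtr //.
apply: (@le_trans _ _ (\sum_(i < n) r ^+ 2)).
  by apply: ler_sum => i _; rewrite lerXn2r ?nnegrE ?normc_ge0.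
rewrite sumr_const card_ord -[leLHS]mulr_natl exprMn ler_wpM2r ?sqr_ge0 //.
by rewrite -natrX ler_nat; case: (n) => // k; rewrite leq_pmulr.
Qed.

(** A quantitative inverse function argument: at a zero [y] at distance [r] from [p], Taylor's
    formula makes [J (y - p)] of order [r ^+ 2], and inverting [J] gives [r <= c * r ^+ 2], which
    forces [r = 0] when [r] is small. *)
Lemma regular_zero_isolated (F : n.-tuple {mpoly C[n]}) (p : 'rV[C]_n) :
  is_zero F p -> jacobian_at F p \in unitmx -> isolated_zero F p.
Proof.
move=> Fp Junit; split=> //; set J := jacobian_at F p in Junit.
have [M0 hM0] := taylor_bound_family (p ord0) (fun i : 'I_n => tnth F i).
have hM i : taylor_bound (p ord0) `|M0| (tnth F i).
  by apply: taylor_boundW (hM0 i); apply: ler_norm.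
set M := `|M0| in hM; have M_ge0 : 0 <= M by apply: normr_ge0.
pose L := \sum_i \sum_j normc (invmx J i j).
have L_ge0 : 0 <= L.
  by apply: sumr_ge0 => i _; apply: sumr_ge0 => j _; apply: normc_ge0.
pose c := n%:R * (L * M); have c0 : 0 <= c by rewrite !mulr_ge0.
(* The bound by [1] keeps [y] in the unit box; using [c + 1] instead of [c] makes [c * s] strictly
   less than [1]. *)
have [s s0 hs] := exists_small_scale [:: 1; c + 1].
have s1 : s <= 1 by rewrite -[s]mulr1 hs ?inE ?eqxx.
have sc : s * (c + 1) <= 1 by rewrite hs ?inE ?eqxx ?orbT.
exists s => // y ys Fy; set r := cvnorm (y - p) in ys.
have r0 : 0 <= r by apply: sqrtr_ge0.
have yp : in_box (p ord0) r (y ord0).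
  by move=> i; have := normc_le_cvnorm (y - p) i; rewrite !mxE.
have yp1 : in_box (p ord0) 1 (y ord0).
  by move=> i; apply: le_trans (yp i) _; apply: le_trans (ltW ys) s1.
have Dle j : normc ((J *m (y - p)^T) j ord0) <= M * r ^+ 2.
  have [_ _] := hM j _ _ _ r0 (in_box0 _ ler01) yp1 yp.
  rewrite [_.@[y ord0]](Fy _ (mem_tnth j F)) [_.@[p ord0]](Fp _ (mem_tnth j F)).
  rewrite subrr sub0r normcN; congr (normc _ <= _).
  by rewrite mxE; apply: eq_bigr => l _; rewrite !mxE.
have coord i : normc ((y - p) ord0 i) <= L * M * r ^+ 2.
  have -> : (y - p) ord0 i = (invmx J *m (J *m (y - p)^T)) i ord0.
    by rewrite mulKmx // [RHS]mxE.
  rewrite mxE; apply: le_trans (normc_sum _ _ _) _.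
  apply: (@le_trans _ _ ((\sum_j normc (invmx J i j)) * (M * r ^+ 2))).
    by rewrite mulr_suml; apply: ler_sum => j _; rewrite normcM ler_wpM2l ?normc_ge0.
  rewrite -mulrA ler_wpM2r ?mulr_ge0 ?sqr_ge0 // /L [leRHS](bigD1 i) //= lerDl.
  by apply: sumr_ge0 => i' _; apply: sumr_ge0 => j _; apply: normc_ge0.
have rle : r <= c * r ^+ 2.
  by rewrite /c -mulrA; apply: cvnorm_le; rewrite // !mulr_ge0 ?sqr_ge0.
have r_eq0 : r = 0.
  apply/eqP; rewrite eq_le r0 andbT leNgt; apply/negP => rpos.
  have cr : 1 <= c * r by rewrite -(ler_pM2r rpos) mul1r -mulrA -expr2.
  have := le_trans cr (ler_wpM2l c0 (ltW ys)).
  by rewrite mulrDr mulr1 mulrC in sc; move: sc s0; clear; lra.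
apply/eqP; rewrite -subr_eq0; apply/eqP/rowP => i; rewrite [RHS]mxE.
apply: eq0_normc; apply/eqP; rewrite eq_le normc_ge0 andbT -r_eq0.
exact: normc_le_cvnorm.
Qed.

Section Deflation.
Variables (N : nat) (F : N.-tuple {mpoly C[n]}) (p : 'rV[C]_n).
Hypothesis Fp : is_zero F p.

Lemma Delta_zero h : Delta F p h -> mpeval h p = 0.
Proof.
elim=> {h} [f /Fp // | c h _ _ h0 | h g _ _ _ _ | //].
  by rewrite /mpeval mevalZ [_.@[_]]h0 mulr0.
by rewrite /mpeval mevalD.
Qed.

(** The side conditions of [Delta] do not obstruct linearity: a zero coefficient leaves [g], and
    sums are always allowed because every element vanishes at [p]. *)
Lemma Delta_lin c h g : Delta F p h -> Delta F p g -> Delta F p (c *: h + g).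
Proof.
move=> Dh Dg; have [->|c0] := eqVneq c 0; first by rewrite scale0r add0r.
have Dch := Delta_scale c0 Dh.
by apply: Delta_add => //; rewrite !Delta_zero // addr0.
Qed.

Lemma Delta_msize h : Delta F p h -> (msize h <= (sysdeg F).+1)%N.
Proof.
elim=> {h} [f fF | c h _ _ | h1 h2 _ IH1 _ IH2 _ | h i _ IH _].
- by apply: leq_trans (leqSpred _) _; rewrite ltnS; apply: leq_bigmax_seq.
- by apply: leq_trans; apply: msizeZ_le.
- by apply: leq_trans (msizeD_le _ _) _; rewrite geq_max IH1.
apply: leq_trans IH; rewrite /mderiv.
apply: leq_trans (msize_sum _ _ _) _; apply/bigmax_leqP_seq => u uh _.
apply: leq_trans (msizeZ_le _ _) _; rewrite msizeX.
by apply: leq_ltn_trans (msize_mdeg_lt uh); apply: mdegB.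
Qed.

Lemma Delta_system_of_independent_gradients (H : 'I_n -> {mpoly C[n]})
    (B : 'M[C]_n) :
  row_free B -> (forall i, Delta F p (H i)) ->
  (forall i, row i B = gradient_at (p ord0) (H i)) ->
  exists F' : n.-tuple {mpoly C[n]},
    [/\ forall f, f \in F' -> Delta F p f, isolated_regular_zero F' p
      & (sysdeg F' <= sysdeg F)%N].
Proof.
move=> Bfree DH HB; exists [tuple H i | i < n].
have DF' f : f \in [tuple H i | i < n] -> Delta F p f.
  by case/tnthP=> i ->; rewrite tnth_mktuple.
have JB : jacobian_at [tuple H i | i < n] p = B.
  apply/matrixP => i j; have /rowP/(_ j) := HB i.
  by rewrite !mxE tnth_mktuple => ->.
split=> //.
  split; last by rewrite JB -leqNgt (eqP Bfree).
  apply: regular_zero_isolated => [f /DF'/Delta_zero // |].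
  by rewrite JB -row_free_unit.
apply/bigmax_leqP_seq => f /DF'/Delta_msize h _.
by case: (msize f) h.
Qed.

Lemma dependent_gradients_not_isolated (k : nat) (H : 'I_k -> {mpoly C[n]})
    (B : 'M[C]_(k, n)) :
  (0 < N)%N -> (k < n)%N -> row_free B -> (forall i, Delta F p (H i)) ->
  (forall i, row i B = gradient_at (p ord0) (H i)) ->
  (forall h, Delta F p h -> (gradient_at (p ord0) h <= B)%MS) ->
  ~ isolated_zero F p.
Proof.
move=> N0 kn Bfree DH HB Bspan [_ [eps eps0 isol]].
have D0 : Delta F p 0.
  have Df := Delta_sys p (mem_tnth (Ordinal N0) F).
  by have := Delta_lin (-1) Df Df; rewrite scaleN1r addNr.
have Dderiv h i : Delta F p h -> (h^`M(i)).@[p ord0] = 0 -> Delta F p h^`M(i).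
  exact: Delta_deriv.
have [u [l [ul Du]]] := subspace_tangent_field Delta_lin Dderiv kn Bfree DH HB Bspan.
have [d [b [Db bgen]]] := bounded_subspace_generators Delta_msize.
have /choice[a uab] i : exists a : 'I_d -> {mpoly C[n]},
    \sum_l (b i)^`M(l) * u l = \sum_j a j * b j.
  have [g [Dg ->]] := Du _ (Db i).
  have [c hc] := choice (fun j => bgen _ (Dg j)).
  (* Expanding each [g l] over the generators [b j] and collecting the components of [u] yields the
     coefficient of [b j]. *)
  exists (fun j => \sum_l c l j *: u l).
  under [RHS]eq_bigr => j _ do rewrite mulr_suml.
  rewrite exchange_big; apply: eq_bigr => l' _ /=.
  rewrite hc mulr_suml; apply: eq_bigr => j _.
  by rewrite -!scalerAl mulrC.
(* A coordinatewise bound [rho] gives norm at most [n * rho]; dividing by [n + 1] makes this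
   strictly less than [eps]. *)
have rho0 : 0 < eps / n.+1%:R by rewrite divr_gt0 ?ltr0Sn.
have [z [zl zp bz]] :=
  tangent_field_zero (fun i => Delta_zero (Db i)) uab ul rho0.
pose y : 'rV[C]_n := \row_i z i.
have yE : y ord0 =1 z by move=> i; rewrite mxE.
case/eqP: zl; rewrite -[z l]yE; congr (_ _ l).
congr fun_of_matrix; apply: isol.
  apply: le_lt_trans (cvnorm_le (ltW rho0) _) _ => [i|].
    by rewrite !mxE.
  rewrite mulrCA gtr_pMr // ltr_pdivrMr ?ltr0Sn // mul1r ltr_nat //.
move=> f fF; have [c ->] := bgen f (Delta_sys p fF).
rewrite /mpeval raddf_sum big1 //= => i _.
by rewrite mevalZ (meval_eq _ yE) bz mulr0.
Qed.

End Deflation.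
End Systems.

Theorem theorem9 (R : realType) (n N m : nat) (F : N.-tuple {mpoly R[i][n]})
    (p : 'rV[R[i]]_n) :
  (n <= N)%N ->
  sysdeg F = m ->
  isolated_singular_zero F p ->
  exists F' : n.-tuple {mpoly R[i][n]},
    [/\ forall f, f \in F' -> Delta F p f,
        isolated_regular_zero F' p
      & (sysdeg F' <= m)%N].
Proof.
move=> nN <- [isol sing].
have Fp : is_zero F p by case: isol.
(* A rank below [n] forces [n > 0]. *)
have N0 : (0 < N)%N by apply: leq_trans nN; apply: leq_ltn_trans sing.
have [k [B [Bfree BP Bspan]]] := row_free_span_exists
  (fun v => exists h, Delta F p h /\ v = gradient_at (p ord0) h).
have [H HP] := choice BP.
have DH i : Delta F p (H i) by case: (HP i).
have HB i : row i B = gradient_at (p ord0) (H i) by case: (HP i).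
have kn : (k <= n)%N by rewrite -(eqP Bfree) rank_leq_col.
(* If the gradients span, the chosen [H i] are the desired system; otherwise [p] would not be
   isolated. *)
move: kn; rewrite leq_eqVlt => /predU1P[kn|kn].
  by subst k; apply: Delta_system_of_independent_gradients Bfree DH HB.
case: (dependent_gradients_not_isolated Fp N0 kn Bfree DH HB _ isol) => h Dh.
by apply: Bspan; exists h.
Qed.
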